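(* Let $p$ be an odd prime, let $q\in\mathbb{C}_p$ with $|1-q|_p<p^{-\frac{1}{p-1}}$, let $x\in\mathbb{Z}_p$ and $t\in\mathbb{C}_p$ with $|t|_p<p^{-\frac{1}{p-1}}$. Then \[ [2]_q\sum_{m=0}^\infty(-q)^m(1+t)^{[m+x]_q}=\sum_{n=0}^\infty Ch_{n,q}(x)\frac{t^n}{n!}. \] In particular, for $x=0$, $[2]_q\sum_{m=0}^\infty(-q)^m(1+t)^{[m]_q}=\sum_{n=0}^\infty Ch_{n,q}\frac{t^n}{n!}$, where $Ch_{n,q}=Ch_{n,q}(0)$.
   Context: For $x\in\mathbb{Z}_p$, $[x]_q=\frac{q^x-1}{q-1}$; $[2]_q=1+q$. The fermionic $p$-adic $q$-integral of a continuous $f:\mathbb{Z}_p\to\mathbb{C}_p$ is $\int_{\mathbb{Z}_p}f(y)\,d\mu_{-q}(y)=\lim_{N\to\infty}\frac{1}{[p^N]_{-q}}\sum_{y=0}^{p^N-1}f(y)(-q)^y$, where $[m]_{-q}=\frac{1-(-q)^m}{1+q}$. The Carlitz-type $q$-Changhee polynomials $Ch_{n,q}(x)$ are defined by $\int_{\mathbb{Z}_p}(1+t)^{[x+y]_q}\,d\mu_{-q}(y)=\sum_{n\ge0}Ch_{n,q}(x)\frac{t^n}{n!}$.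
   Formalization: The left-hand series never converges in C_p (all its terms have absolute value 1), so its sum is read as the value at z=1 of the Krasner analytic continuation of the power series with terms (-q)^m(1+t)^{[m+x]_q}z^m; likewise for x=0. *)

(* Defs.v *)
From HB Require Import structures.
From mathcomp Require Import all_boot all_order all_algebra.
From mathcomp Require Import all_classical all_reals all_analysis.

Set Implicit Arguments.
Unset Strict Implicit.
Unset Printing Implicit Defensive.

Import Order.TTheory GRing.Theory Num.Theory.
Import numFieldNormedType.Exports.

Local Open Scope classical_set_scope.
Local Open Scope ring_scope.

(* The norms of the library satisfy |x *+ n| = |x| *+ n, which excludes p-adic
   absolute values; the topology is therefore derived from a metricType. *)
Record ultrametricField (R : realType) := UltrametricField {
  uf_field : closedFieldType ;
  uf_abs : uf_field -> R ;
  _ : forall x, 0 <= uf_abs x ;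
  _ : forall x, (uf_abs x == 0) = (x == 0) ;
  _ : forall x y, uf_abs (x * y) = uf_abs x * uf_abs y ;
  _ : forall x y, uf_abs (x + y) <= Num.max (uf_abs x) (uf_abs y)
}.

Definition uf_sort (R : realType) (K : ultrametricField R) : Type := uf_field K.
Coercion uf_sort : ultrametricField >-> Sortclass.

HB.instance Definition _ (R : realType) (K : ultrametricField R) :=
  GRing.ClosedField.copy (uf_sort K) (uf_field K).

Definition pabs (R : realType) (K : ultrametricField R) (x : K) : R :=
  @uf_abs R K x.

Section UltrametricTheory.
Context {R : realType} {K : ultrametricField R}.
Implicit Types x y z : K.

Lemma pabs_ge0 x : 0 <= pabs x.
Proof. by rewrite /pabs; case: K x. Qed.

Lemma pabs_eq0 x : (pabs x == 0) = (x == 0).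
Proof. by rewrite /pabs; case: K x. Qed.

Lemma pabsM x y : pabs (x * y) = pabs x * pabs y.
Proof. by rewrite /pabs; case: K x y. Qed.

Lemma pabsD x y : pabs (x + y) <= Num.max (pabs x) (pabs y).
Proof. by rewrite /pabs; case: K x y. Qed.

Lemma pabs0 : pabs (0 : K) = 0.
Proof. by apply/eqP; rewrite pabs_eq0. Qed.

Lemma pabs_neq0 x : x != 0 -> 0 < pabs x.
Proof. by move=> x0; rewrite lt_neqAle pabs_ge0 andbT eq_sym pabs_eq0. Qed.

Lemma pabs1 : pabs (1 : K) = 1.
Proof.
have n0 : pabs (1 : K) != 0 by rewrite pabs_eq0 oner_neq0.
by apply: (mulfI n0); rewrite -pabsM !mulr1.
Qed.

Lemma pabsN x : pabs (- x) = pabs x.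
Proof.
suff N1 : pabs (-1 : K) = 1 by rewrite -mulN1r pabsM N1 mul1r.
have /eqP : pabs (-1 : K) ^+ 2 = 1 by rewrite expr2 -pabsM mulrNN mulr1 pabs1.
by rewrite sqrp_eq1 ?pabs_ge0// => /eqP.
Qed.

Lemma pabsB x y : pabs (x - y) = pabs (y - x).
Proof. by rewrite -opprB pabsN. Qed.

Lemma pabs_triangle x y z : pabs (x - z) <= pabs (x - y) + pabs (y - z).
Proof.
have -> : x - z = (x - y) + (y - z) by rewrite addrA subrK.
by apply: (le_trans (pabsD _ _)); rewrite ge_max lerDl lerDr !pabs_ge0.
Qed.

End UltrametricTheory.

Section UltrametricMetric.
Variables (R : realType) (K : ultrametricField R).

Let dist (x y : K) : R := pabs (x - y).
Let dist_xx x : dist x x = 0. Proof. by rewrite /dist subrr pabs0. Qed.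
Let dist_eq0 x y : dist x y = 0 -> x = y.
Proof. by move/eqP; rewrite pabs_eq0 subr_eq0 => /eqP. Qed.
Let dist_sym x y : dist x y = dist y x. Proof. exact: pabsB. Qed.
Let dist_triangle y x z : dist x z <= dist x y + dist y z.
Proof. exact: pabs_triangle. Qed.

HB.instance Definition _ := isMetric.Build R (uf_sort K)
  dist_xx dist_eq0 dist_sym dist_triangle.
HB.instance Definition _ := isPointed.Build (uf_sort K) 0.

End UltrametricMetric.

Lemma mdist_pabs (R : realType) (K : ultrametricField R) (x y : K) :
  mdist x y = pabs (x - y).
Proof. by []. Qed.

Lemma ball_pabs (R : realType) (K : ultrametricField R) (x y : K) (e : R) :
  ball x e y = (pabs (x - y) < e).
Proof. by rewrite ballEmdist. Qed.

(* K is C_p, the completion of an algebraic closure of Q_p.  These axioms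
   determine it up to isometric isomorphism: the closure of the prime field is
   a copy of Q_p, over which the elements of a dense subset are algebraic. *)
Record is_padic_complex (R : realType) (p : nat) (K : ultrametricField R) :
    Prop := IsPadicComplex {
  pabs_p : pabs (p%:R : K) = p%:R^-1 ;
  padic_complete :
    forall F : set_system K, ProperFilter F -> cauchy F -> cvg F ;
  algebraic_dense : dense
    [set x : K | exists P : {poly K}, [/\ P != 0,
      forall i, closure (range (ratr : rat -> K)) P`_i & root P x]]
}.

Section Changhee.
Context {R : realType} {K : ultrametricField R}.
Implicit Types (p n : nat) (a q t x y z S : K) (u : nat -> K).

(* Z_p, as a subring of C_p. *)
Definition padic_int : set K := closure (range (fun n : int => n%:~R : K)).

(* p^(-1/(p-1)) *)
Definition exp_radius p : R := p%:R `^ (- (p.-1)%:R^-1).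

Definition gbinom a n : K := (\prod_(i < n) (a - i%:R)) / n`!%:R.

(* (1+t)^a as the binomial series; it converges for |a| <= 1 and
   |t| < exp_radius p, where it agrees with exp (a log (1+t)). *)
Definition pow1p t a : K :=
  lim (series (fun n => gbinom a n * t ^+ n) @ \oo).

Definition qpow q x : K := pow1p (q - 1) x.

(* [x]_q ; at q = 1 the quotient (q^x - 1)/(q - 1) stands for its limit x. *)
Definition qnum q x : K := if q == 1 then x else (qpow q x - 1) / (q - 1).

Definition fermionic_integral p q (f : K -> K) : K :=
  lim (((1 - (- q) ^+ (p ^ N)) / (1 + q))^-1
       * (\sum_(0 <= y < p ^ N) f y%:R * (- q) ^+ y) @[N --> \oo]).

(* Ch_{n,q}(x), defined by its generating function in t. *)
Definition Changhee_poly p q x : nat -> K :=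
  get [set c : nat -> K | forall t, pabs t < exp_radius p ->
    series (fun n => c n * (t ^+ n / n`!%:R)) @ \oo -->
      fermionic_integral p q (fun y => pow1p t (qnum q (x + y)))].

Definition Changhee_number p q : nat -> K := Changhee_poly p q 0.

Definition residue_discs01 : set K := [set z | pabs z < 1 \/ pabs (z - 1) < 1].

(* u 0 + u 1 + u 2 + ... = S in the sense of analytic continuation: the power
   series of the u m, on |z| < 1, extends to a Krasner analytic element (a
   uniform limit of rational functions without poles) on the union of the
   residue discs of 0 and 1, with value S at 1.  In C_p such an S is unique, and
   is the ordinary sum when the series converges (see krasner_sum_unique and
   cvg_krasner_sum).  The extension is needed for the sum of the (-q)^m f(m)
   with |q| = 1, whose terms do not tend to 0: here it amounts to giving every
   geometric series of ratio r, where |r| = |1-r| = 1, the value 1/(1-r). *)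
Definition krasner_sum u S :=
  exists F : K -> K, exists P Q : nat -> {poly K},
  [/\ forall k z, residue_discs01 z -> ~~ root (Q k) z,
      {uniform residue_discs01,
        (fun k z => (P k).[z] / (Q k).[z]) @ \oo --> F},
      forall z, pabs z < 1 -> series (fun m => u m * z ^+ m) @ \oo --> F z
    & F 1 = S].

End Changhee.

Section KrasnerSum.
Context {R : realType} {p : nat} {K : ultrametricField R}.
Hypotheses (p_prime : prime p) (hK : is_padic_complex p K).
Implicit Types (z a : K) (A B : {poly K}).

Let pabsX z n : pabs (z ^+ n) = pabs z ^+ n.
Proof. by elim: n => [|n IH]; rewrite ?expr0 ?pabs1// !exprS pabsM IH. Qed.

Let pabsV z : pabs z^-1 = (pabs z)^-1.
Proof.
have [->|z0] := eqVneq z 0; first by rewrite invr0 pabs0 invr0.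
have pz : pabs z != 0 by rewrite pabs_eq0.
by apply: (mulfI pz); rewrite -pabsM !divff// pabs1.
Qed.

Let pabs_prod (s : seq K) (f : K -> K) :
  pabs (\prod_(a <- s) f a) = \prod_(a <- s) pabs (f a).
Proof. by elim: s => [|a s IH]; rewrite ?big_nil ?pabs1// !big_cons pabsM IH. Qed.

Let pabs_horner A z (s : seq K) :
  A = lead_coef A *: \prod_(a <- s) ('X - a%:P) ->
  pabs A.[z] = pabs (lead_coef A) * \prod_(a <- s) pabs (z - a).
Proof.
move=> ->; rewrite lead_coefZ lead_coef_prod_XsubC mulr1 hornerZ pabsM.
rewrite horner_prod pabs_prod.
by congr (_ * _); apply: eq_bigr => a _; rewrite !hornerE.
Qed.

Let pabs_lt a z : pabs a < pabs z -> pabs (z - a) = pabs z.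
Proof.
move=> az; apply/le_anti/andP; split.
  by apply: (le_trans (pabsD _ _)); rewrite pabsN ge_max lexx ltW.
have : pabs z <= Num.max (pabs (z - a)) (pabs a).
  by rewrite -[in leLHS](subrK a z) pabsD.
by rewrite le_max => /orP[//|]; rewrite leNgt az.
Qed.

Let denominator z B : pabs z < 1 ->
  (forall z', residue_discs01 z' -> ~~ root B z') ->
  pabs B.[z] = pabs B.[1].
Proof.
move=> z1 Bn0; have [s sE] := closed_field_poly_normal B.
rewrite (pabs_horner z sE) (pabs_horner 1 sE); congr (_ * _).
apply: eq_big_seq => b bs.
have Bnz : lead_coef B != 0.
  rewrite lead_coef_eq0; apply/eqP => B0.
  suff /(Bn0 0) : residue_discs01 (0 : K) by rewrite B0 root0.
  by left; rewrite pabs0.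
have rb : root B b by rewrite sE rootZ// root_prod_XsubC.
have b1 : 1 <= pabs b.
  by rewrite leNgt; apply/negP => h; move: (Bn0 b (or_introl h)); rewrite rb.
have bB1 : 1 <= pabs (b - 1).
  by rewrite leNgt; apply/negP => h; move: (Bn0 b (or_intror h)); rewrite rb.
rewrite pabsB (pabs_lt (lt_le_trans z1 b1)) (pabsB 1).
have [b1'|b1'] := ltP 1 (pabs b); first by rewrite pabs_lt// pabs1.
have bE : pabs b = 1 by apply/le_anti; rewrite b1 b1'.
rewrite bE; apply/le_anti; rewrite bB1 andTb.
by apply: (le_trans (pabsD _ _)); rewrite pabsN pabs1 bE maxxx.
Qed.

Let numerator A : exists2 z, pabs z < 1 & pabs A.[1] / p%:R <= pabs A.[z].
Proof.
have [s sE] := closed_field_poly_normal A.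
have p0 : 0 < p%:R :> R by rewrite ltr0n prime_gt0.
have p1 : p%:R^-1 < 1 :> R by rewrite invf_lt1// ltr1n prime_gt1.
have [rho [r0 r1 rs]] : exists rho : R, [/\ 0 <= rho, rho < 1 &
    forall a, a \in s -> pabs a < 1 -> pabs a <= rho].
  elim: (s) => [|a s' [rho [r0 r1 rs]]]; first by exists 0.
  have [a1|a1] := ltP (pabs a) 1.
    exists (Num.max rho (pabs a)); split; rewrite ?le_max ?r0 ?gt_max ?r1//.
    move=> b; rewrite inE => /orP[/eqP-> _|bs b1]; first by rewrite le_max lexx orbT.
    by rewrite le_max rs.
  exists rho; split=> // b; rewrite inE => /orP[/eqP->|]; last exact: rs.
  by rewrite ltNge a1.
have [n ns rn] : exists2 n, (size s < n)%N & rho ^+ n < p%:R^-1.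
  have rho1 : `|rho| < 1 by rewrite ger0_norm.
  have pV0 : 0 < p%:R^-1 :> R by rewrite invr_gt0.
  have /cvgrPdist_lt/(_ _ pV0) [N _ hN] := cvg_expr rho1.
  exists (maxn N (size s).+1); first by rewrite leq_max leqnn orbT.
  have /= := hN _ (leq_maxl N (size s).+1).
  by rewrite sub0r normrN ger0_norm ?exprn_ge0.
have n0 : (0 < n)%N by apply: leq_ltn_trans ns.
have [z zE] : exists z : K, z ^+ n = p%:R.
  have /closed_rootP[z] : size ('X^n - (p%:R)%:P : {poly K}) != 1%N.
    by rewrite size_XnsubC// eqSS -lt0n.
  by rewrite rootE !hornerE subr_eq0 => /eqP; exists z.
have zn : pabs z ^+ n = p%:R^-1 by rewrite -pabsX zE (pabs_p hK).
have z1 : pabs z < 1.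
  rewrite ltNge; apply/negP => z1; have := exprn_ege1 n z1.
  by rewrite zn leNgt p1.
have rz : rho < pabs z.
  rewrite ltNge; apply/negP => zr.
  have : pabs z ^+ n <= rho ^+ n by rewrite lerXn2r// nnegrE pabs_ge0.
  by rewrite zn leNgt rn.
have z_gt0 : 0 < pabs z by apply: le_lt_trans rz.
exists z => //; rewrite (pabs_horner z sE) (pabs_horner 1 sE) -mulrA.
apply: ler_wpM2l; first exact: pabs_ge0.
have step : (\prod_(a <- s) pabs (1 - a)) * pabs z ^+ size s
    <= \prod_(a <- s) pabs (z - a).
  have : forall a, a \in s -> pabs (1 - a) * pabs z <= pabs (z - a).
    move=> a /rs ars; have [a1|a1] := ltP (pabs a) 1.
      rewrite (@pabs_lt a 1) ?pabs1// mul1r pabs_lt//.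
      exact: le_lt_trans (ars a1) rz.
    rewrite (pabsB z) (@pabs_lt z a) ?(lt_le_trans z1)//.
    apply: (@le_trans _ _ (pabs (1 - a))).
      by rewrite ler_piMr ?pabs_ge0// ltW.
    apply: (le_trans (pabsD _ _)).
    by rewrite pabsN pabs1 ge_max a1 lexx.
  elim: (s) => [|a s' IH] h; first by rewrite !big_nil expr0 mulr1.
  rewrite !big_cons /= exprS mulrACA ler_pM ?mulr_ge0 ?pabs_ge0//.
  - by rewrite prodr_ge0// => b _; exact: pabs_ge0.
  - exact: exprn_ge0 (pabs_ge0 _).
  - by apply: h; rewrite mem_head.
  by apply: IH => b bs; apply: h; rewrite inE bs orbT.
apply: le_trans step; apply: ler_wpM2l.
  by rewrite prodr_ge0// => b _; exact: pabs_ge0.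
by rewrite -zn; apply: ler_wiXn2l; [exact: pabs_ge0|exact: ltW|exact: ltnW].
Qed.

Lemma krasner_sum_unique (u : nat -> K) S S' :
  krasner_sum u S -> krasner_sum u S' -> S = S'.
Proof.
move=> [F [P [Q [Q0 cF uF <-]]]] [F' [P' [Q' [Q'0 cF' uF' <-]]]].
have FF' z : pabs z < 1 -> F z = F' z.
  move=> z1; exact: (cvg_unique (@metric_hausdorff R K) (uF z z1) (uF' z z1)).
have unif (G : K -> K) (A B : nat -> {poly K}) (e : R) : 0 < e ->
    {uniform residue_discs01, (fun k z => (A k).[z] / (B k).[z]) @ \oo --> G} ->
    \forall k \near \oo, forall z, residue_discs01 z ->
      pabs (G z - (A k).[z] / (B k).[z]) < e.
  move=> e0 /(_ [set h | forall z, residue_discs01 z -> pabs (G z - h z) < e]).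
  apply; apply/uniform_nbhs; exists [set xy | ball xy.1 e xy.2]; split.
    exact: entourage_ball (PosNum e0).
  by move=> h hG z /hG /=; rewrite ball_pabs.
have p0 : 0 < p%:R :> R by rewrite ltr0n prime_gt0.
apply/eqP; rewrite -subr_eq0 -pabs_eq0; apply/eqP/le_anti.
rewrite pabs_ge0 andbT; apply/ler_addgt0Pl => e e0; rewrite addr0.
pose d := Num.min e (e / p%:R).
have d0 : 0 < d by rewrite lt_min e0 divr_gt0.
have [k [hk hk']] := @filter_ex _ _ _ _ (filterI (unif _ _ _ _ d0 cF) (unif _ _ _ _ d0 cF')).
pose A := P k * Q' k - P' k * Q k; pose B := Q k * Q' k.
have B0 z : residue_discs01 z -> ~~ root B z.
  by move=> Dz; rewrite rootM negb_or Q0// Q'0.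
have AB z : residue_discs01 z ->
    A.[z] / B.[z] = (P k).[z] / (Q k).[z] - (P' k).[z] / (Q' k).[z].
  move=> Dz; have := Q0 k z Dz; have := Q'0 k z Dz; rewrite !rootE => q' q.
  by rewrite !hornerE -[X in _ = _ + X]mulNr addf_div// mulNr.
have D1 : residue_discs01 (1 : K) by right; rewrite subrr pabs0.
have [z z1 hz] := numerator A.
have Dz : residue_discs01 z by left.
have ABz : pabs (A.[z] / B.[z]) <= d.
  rewrite AB//.
  have -> : (P k).[z] / (Q k).[z] - (P' k).[z] / (Q' k).[z] =
    (F' z - (P' k).[z] / (Q' k).[z]) - (F z - (P k).[z] / (Q k).[z]).
    by rewrite FF'// opprB [RHS]addrC subrKA.
  apply: (le_trans (pabsD _ _)); rewrite pabsN ge_max.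
  by rewrite !ltW ?hk ?hk'.
have AB1 : pabs (A.[1] / B.[1]) <= e.
  rewrite pabsM pabsV -(denominator z1 B0) -pabsV.
  apply: (@le_trans _ _ (pabs (A.[z] / B.[z]) * p%:R)).
    rewrite pabsM mulrAC; apply: ler_wpM2r; first exact: pabs_ge0.
    by rewrite -ler_pdivrMr.
  by rewrite -ler_pdivlMr// (le_trans ABz)// ge_min lexx orbT.
have -> : F 1 - F' 1 = (F 1 - (P k).[1] / (Q k).[1]) +
    (A.[1] / B.[1] - (F' 1 - (P' k).[1] / (Q' k).[1])).
  by rewrite AB// opprB !subrKA.
have de : d <= e by rewrite ge_min lexx.
apply: (le_trans (pabsD _ _)); rewrite ge_max (le_trans (ltW (hk _ D1)))//=.
apply: (le_trans (pabsD _ _)); rewrite pabsN ge_max AB1/=.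
exact: le_trans (ltW (hk' _ D1)) de.
Qed.

Lemma cvg_krasner_sum (u : nat -> K) S :
  series u @ \oo --> S -> krasner_sum u S.
Proof.
move=> uS; pose s z := series (fun m => u m * z ^+ m).
have cvgP (v : nat -> K) l : v @ \oo --> l <-> (forall e : R, 0 < e ->
    \forall n \near \oo, pabs (l - v n) < e).
  split=> [vl e e0|vl].
    have vle := vl _ (nbhsx_ballx l e e0); by case: vle => N _ hN; exists N.
  move=> W /nbhs_ballP[e /= e0 eW]; have [N _ hN] := vl e e0.
  exists N => // n /hN /= h.
  by apply: eW; rewrite ball_pabs.
have tail e : 0 < e -> exists N, forall z, pabs z <= 1 ->
    forall m n, (N <= m)%N -> (m <= n)%N -> pabs (s z n - s z m) < e.
  move=> e0; have /cvgP/(_ e e0) [N _ hN] := uS; exists N => z z1 m n Nm mn.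
  rewrite /s /series /= -(subnKC mn); elim: (n - m)%N => [|k IH].
    by rewrite addn0 subrr pabs0.
  rewrite addnS big_nat_recr //= addrAC; apply: le_lt_trans (pabsD _ _) _.
  rewrite gt_max IH /= pabsM pabsX.
  have -> : u (m + k)%N = (S - series u (m + k)%N) - (S - series u (m + k).+1).
    by rewrite opprB addrC subrKA /series /= big_nat_recr//= addrAC subrr add0r.
  apply: (@le_lt_trans _ _ (pabs (S - series u (m + k)%N - (S - series u (m + k).+1)))).
    by rewrite ler_piMr ?pabs_ge0// exprn_ile1 ?pabs_ge0.
  apply: le_lt_trans (pabsD _ _) _; rewrite pabsN gt_max.
  by apply/andP; split; apply: hN => /=; rewrite ?(leq_trans Nm) ?leqW ?leq_addr.
have scvg z : pabs z <= 1 -> cvg (s z @ \oo).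
  move=> z1; apply: (padic_complete hK).
  apply: cauchy_exP => e e0; have [N hN] := tail e e0.
  by exists (s z N); exists N => // n /= Nn; rewrite ball_pabs pabsB hN.
pose F z := lim (s z @ \oo).
have D1 z : residue_discs01 z -> pabs z <= 1.
  move=> [/ltW//|z1]; rewrite -(subrK 1 z); apply: le_trans (pabsD _ _) _.
  by rewrite pabs1 ge_max lexx ltW.
exists F, (fun k => \poly_(m < k) u m), (fun=> 1); split.
- by move=> k z _; rewrite root1.
- move=> W /uniform_nbhs[E [entE EW]].
  have [e e0 eE] : exists2 e : R, 0 < e & forall x y : K, ball x e y -> E (x, y).
    by move: entE; rewrite -entourage_ballE => -[e /= e0 he]; exists e => // x y ?;
      exact: (he (x, y)).
  have [N hN] := tail e e0.
  exists N => // k /= Nk; apply: EW => z Dz; apply: eE.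
  have z1 := D1 z Dz.
  have -> : (\poly_(m < k) u m).[z] / (1 : {poly K}).[z] = s z k.
    by rewrite hornerC divr1 horner_poly /s /series /= big_mkord.
  have [M _ hM] := (cvgP _ _).1 (scvg z z1) e e0.
  have := hM (maxn M k) (leq_maxl _ _) => /= hM'.
  rewrite ball_pabs; have -> : F z - s z k =
    (F z - s z (maxn M k)) + (s z (maxn M k) - s z k) by rewrite subrKA.
  by apply: le_lt_trans (pabsD _ _) _; rewrite gt_max hM' hN ?leq_maxr.
- by move=> z /ltW z1; exact: scvg.
apply/esym/(cvg_unique (@metric_hausdorff R K) uS).
suff -> : series u = s 1 by apply: scvg; rewrite pabs1.
by rewrite /s; congr series; apply/funext => m; rewrite expr1n mulr1.
Qed.

End KrasnerSum.

(* Main.v *)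
(* A function f on the naturals that is a uniform limit of polynomials ("tame")
   has iterated differences tending uniformly to 0.  For |w| <= 1 = |1 - w| the
   Euler transform E_w f = \sum_j (Delta^j f)(0) w^j / (1 - w)^(j+1) therefore
   converges, is linear in f and bounded by sup |f|, and satisfies
   E_w f = f(0) + w E_w (f shifted by 1), hence
     E_w f = \sum_(m < M) f(m) w^m + w^M E_w (f shifted by M).
   - For |w| < 1 this gives E_w f = \sum_m f(m) w^m.  As the partial sums of the
     Euler transform are rational in w and converge uniformly, z |-> E_(-qz) f
     is the continuation required by Krasner summation, and
     \sum_m (-q)^m f(m) has the value E_(-q) f.
   - For w = -q and M = p^N it shows that the fermionic integral of f is
     (1 + q) E_(-q) f, since the shift by p^N moves f uniformly little.
   It remains to see that m |-> (1+t)^[x+m]_q and its t-coefficients are tame,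
   with an expansion in t that converges uniformly in m. *)
Require Import Defs.
From mathcomp Require Import all_boot all_order all_algebra.
From mathcomp Require Import all_classical all_reals all_analysis.
From mathcomp Require Import ring zify.

Set Implicit Arguments.
Unset Strict Implicit.
Unset Printing Implicit Defensive.

Import Order.TTheory GRing.Theory Num.Theory.
Import numFieldNormedType.Exports.

Local Open Scope classical_set_scope.
Local Open Scope ring_scope.

(** * Ultrametric estimates, limits and series *)

Section UltrametricAnalysis.
Context {R : realType} {K : ultrametricField R}.
Implicit Types (a b w x y z : K) (u v : nat -> K) (e B : R) (P Q : {poly K}).

Lemma pabsX x n : pabs (x ^+ n) = pabs x ^+ n.
Proof. by elim: n => [|n IH]; rewrite ?expr0 ?pabs1// !exprS pabsM IH. Qed.

Lemma pabsV x : pabs x^-1 = (pabs x)^-1.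
Proof.
have [->|x0] := eqVneq x 0; first by rewrite invr0 pabs0 invr0.
have px : pabs x != 0 by rewrite pabs_eq0.
by apply: (mulfI px); rewrite -pabsM !divff// pabs1.
Qed.

Lemma pabsD_le x y e : pabs x <= e -> pabs y <= e -> pabs (x + y) <= e.
Proof. by move=> xe ye; apply: le_trans (pabsD _ _) _; rewrite ge_max xe. Qed.

Lemma pabsB_le x y e : pabs x <= e -> pabs y <= e -> pabs (x - y) <= e.
Proof. by move=> xe ye; apply: pabsD_le; rewrite ?pabsN. Qed.

Lemma pabsM_le1 x y e : pabs x <= e -> pabs y <= 1 -> pabs (x * y) <= e.
Proof.
by move=> xe y1; rewrite pabsM; apply: le_trans xe; rewrite ler_piMr ?pabs_ge0.
Qed.

Lemma pabs_sum_le (I : Type) (r : seq I) (A : pred I) (f : I -> K) e :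
  0 <= e -> (forall i, A i -> pabs (f i) <= e) ->
  pabs (\sum_(i <- r | A i) f i) <= e.
Proof.
move=> e0 fe; elim/big_ind: _ => //; first by rewrite pabs0.
by move=> x y; exact: pabsD_le.
Qed.

Lemma pabs_natr_le1 n : pabs (n%:R : K) <= 1.
Proof.
elim: n => [|n IH]; first by rewrite pabs0.
by rewrite -natr1; apply: pabsD_le; rewrite ?pabs1.
Qed.

Lemma pabs1D x : pabs x < 1 -> pabs (1 + x) = 1.
Proof.
move=> x1; apply/le_anti/andP; split.
  by apply: pabsD_le; rewrite ?pabs1 // ltW.
have : pabs (1 : K) <= Num.max (pabs (1 + x)) (pabs x).
  by rewrite -[in leLHS](addrK x 1) -[pabs x]pabsN pabsD.
by rewrite pabs1 le_max => /orP[//|]; rewrite leNgt x1.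
Qed.

Lemma pabs_lt_eq x y : pabs y < pabs x -> pabs (x + y) = pabs x.
Proof.
move=> yx; have x0 : x != 0.
  by rewrite -pabs_eq0 gt_eqF// (le_lt_trans (pabs_ge0 y)).
have -> : x + y = x * (1 + x^-1 * y) by rewrite mulrDr mulr1 mulVKf.
rewrite pabsM pabs1D ?mulr1//.
by rewrite pabsM pabsV mulrC ltr_pdivrMr ?mul1r ?pabs_neq0.
Qed.

Lemma cvg_pabsP u a : u @ \oo --> a <->
  forall e, 0 < e -> exists N, forall n, (N <= n)%N -> pabs (u n - a) <= e.
Proof.
split=> [ua e e0|ua W /nbhs_ballP[e /= e0 eW]].
  have [N _ hN] := ua _ (nbhsx_ballx a e e0); exists N => n Nn.
  by have /= := hN n Nn; rewrite ball_pabs pabsB => /ltW.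
have [|N hN] := ua (e / 2); first by rewrite divr_gt0.
exists N => // n /= /hN h; apply: eW; rewrite ball_pabs pabsB.
by apply: (le_lt_trans h); rewrite gtr_pMr// invf_lt1// ltr1n.
Qed.

Lemma cvg_pabs_unique u a b : u @ \oo --> a -> u @ \oo --> b -> a = b.
Proof. exact: (cvg_unique (@metric_hausdorff R K)). Qed.

Definition null u :=
  forall e, 0 < e -> exists N, forall n, (N <= n)%N -> pabs (u n) <= e.

Definition unif_null (g : nat -> nat -> K) := forall e, 0 < e ->
  exists N, forall n, (N <= n)%N -> forall m, pabs (g n m) <= e.

Lemma unif_null_null (g : nat -> nat -> K) m : unif_null g -> null (g ^~ m).
Proof. by move=> g0 e /g0[N hN]; exists N => n /hN. Qed.

Lemma unif_null_geometric (g : nat -> nat -> K) (r : R) : 0 <= r < 1 ->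
  (forall n m, pabs (g n m) <= r ^+ n) -> unif_null g.
Proof.
move=> /andP[r0 r1] gr e e0; have nr : `|r| < 1 by rewrite ger0_norm.
have /cvgrPdist_le/(_ e e0)[N _ hN] := cvg_expr nr.
exists N => n Nn m; apply: (le_trans (gr n m)); have /= := hN n Nn.
by rewrite sub0r normrN; apply: le_trans; exact: ler_norm.
Qed.

Lemma null_geometric (r : R) u : 0 <= r < 1 ->
  (forall n, pabs (u n) <= r ^+ n) -> null u.
Proof.
move=> hr ur; apply: (unif_null_null (g := fun n _ => u n) 0%N).
exact: (unif_null_geometric hr).
Qed.

Lemma series_tail_le u e k n : 0 <= e ->
  (forall j, (k <= j)%N -> pabs (u j) <= e) -> (k <= n)%N ->
  pabs (series u n - series u k) <= e.
Proof.
move=> e0 ue kn; rewrite sub_series_geq// big_nat_cond; apply: pabs_sum_le => // i.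
by rewrite andbT => /andP[/ue].
Qed.

(** Closed balls are closed: otherwise some [u n] within half of [pabs (a - b)] of [a] would split
    [a - b] into two strictly smaller parts. *)
Lemma pabs_cvg_le u a b B : u @ \oo --> a ->
  (exists N, forall n, (N <= n)%N -> pabs (u n - b) <= B) -> pabs (a - b) <= B.
Proof.
move=> /cvg_pabsP ua [N hN]; rewrite leNgt; apply/negP => Bab.
have B0 : 0 <= B by apply: le_trans (hN N (leqnn N)); exact: pabs_ge0.
have e0 : 0 < (pabs (a - b)) / 2 by rewrite divr_gt0// (le_lt_trans B0).
have {e0}[M hM] := ua _ e0.
have := hM (maxn M N) (leq_maxl _ _); have := hN (maxn M N) (leq_maxr _ _).
move=> cb ca.
suff : pabs (a - b) < pabs (a - b) by rewrite ltxx.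
rewrite -[in ltLHS](subrKA (u (maxn M N))); apply: le_lt_trans (pabsD _ _) _.
rewrite gt_max (le_lt_trans cb Bab) andbT (pabsB a (u _)); apply: le_lt_trans ca _.
by rewrite gtr_pMr ?(le_lt_trans B0 Bab)// invf_lt1// ltr1n.
Qed.

Section Complete.
Context {p : nat}.
Hypothesis hK : is_padic_complex p K.

(** By the ultrametric inequality a block of terms is no larger than its largest term, so the
    partial sums are Cauchy. *)
Lemma is_cvg_series_null u : null u -> series u @ \oo --> lim (series u @ \oo).
Proof.
move=> u0; apply: (padic_complete hK); apply: cauchy_exP => e e0.
have [|N hN] := u0 (e / 2); first by rewrite divr_gt0.
exists (series u N); exists N => // n /= Nn; rewrite ball_pabs pabsB.
apply: (@le_lt_trans _ _ (e / 2)); last by rewrite gtr_pMr// invf_lt1// ltr1n.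
by apply: series_tail_le => //; rewrite divr_ge0// ltW.
Qed.

Lemma lim_series_tail_le u e k : null u -> 0 <= e ->
  (forall j, (k <= j)%N -> pabs (u j) <= e) ->
  pabs (lim (series u @ \oo) - series u k) <= e.
Proof.
move=> u0 e0 ue; apply: (pabs_cvg_le (is_cvg_series_null u0)).
by exists k => n; exact: series_tail_le.
Qed.

Lemma lim_series_le u e : null u -> 0 <= e -> (forall j, pabs (u j) <= e) ->
  pabs (lim (series u @ \oo)) <= e.
Proof.
move=> u0 e0 ue; have := @lim_series_tail_le u e 0 u0 e0 (fun j _ => ue j).
by rewrite /series /= big_geq// subr0.
Qed.

End Complete.

(** Induction along Horner's scheme. On the closed unit disc one constant serves both as bound and
    as Lipschitz constant. *)
Lemma horner_lipschitz P : exists2 B, 0 <= B & forall x y,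
  pabs x <= 1 -> pabs y <= 1 ->
  pabs P.[x] <= B /\ pabs (P.[x] - P.[y]) <= B * pabs (x - y).
Proof.
elim/poly_ind: P => [|P c [B B0 IH]].
  by exists 0 => // x y _ _; rewrite !horner0 subrr pabs0 mul0r.
exists (Num.max B (pabs c)); first by rewrite le_max B0.
move=> x y x1 y1; have [Px Pxy] := IH x y x1 y1.
rewrite !hornerMXaddC; split.
  apply: pabsD_le; last by rewrite le_max lexx orbT.
  by apply: pabsM_le1 => //; rewrite le_max Px.
have -> : P.[x] * x + c - (P.[y] * y + c) =
  P.[x] * (x - y) + (P.[x] - P.[y]) * y by ring.
apply: (@le_trans _ _ (B * pabs (x - y))); last first.
  by apply: ler_wpM2r; rewrite ?pabs_ge0// le_max lexx.
apply: pabsD_le; last exact: pabsM_le1.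
by rewrite pabsM; apply: ler_wpM2r; rewrite ?pabs_ge0.
Qed.

End UltrametricAnalysis.

(** * Uniform limits of polynomials on the naturals, and their differences *)

Section Tame.
Context {R : realType} {K : ultrametricField R}.
Implicit Types (a c w x y z : K) (f g : nat -> K) (e B : R) (P Q : {poly K}).

(** When [K] is C_p, these are by Mahler's theorem the restrictions to the naturals of the
    continuous functions on Z_p. *)
Definition tame f := forall e, 0 < e ->
  exists P : {poly K}, forall m : nat, pabs (f m - P.[m%:R]) <= e.

Lemma eq_tame f g : f =1 g -> tame f -> tame g.
Proof. by move=> /funext ->. Qed.

Lemma tame_horner P : tame (fun m => P.[m%:R]).
Proof. by move=> e e0; exists P => m; rewrite subrr pabs0 ltW. Qed.

Lemma tame_cst c : tame (fun=> c).
Proof. by apply: (eq_tame _ (tame_horner c%:P)) => m; rewrite hornerC. Qed.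

Lemma tame_bounded f : tame f -> exists2 B, 0 < B & forall m, pabs (f m) <= B.
Proof.
move=> /(_ 1 ltr01)[P fP]; have [B B0 hB] := horner_lipschitz P.
exists (Num.max B 1); first by rewrite lt_max ltr01 orbT.
move=> m; rewrite -(subrK P.[m%:R] (f m)); apply: pabsD_le.
  by rewrite le_max fP orbT.
by have [Pm _] := hB _ m%:R (pabs_natr_le1 m) (pabs_natr_le1 m); rewrite le_max Pm.
Qed.

Lemma tameD f g : tame f -> tame g -> tame (fun m => f m + g m).
Proof.
move=> tf tg e e0; have [P fP] := tf e e0; have [Q gQ] := tg e e0.
exists (P + Q) => m; rewrite hornerD opprD addrACA; exact: pabsD_le.
Qed.

Lemma tameM f g : tame f -> tame g -> tame (fun m => f m * g m).
Proof.
move=> tf tg e e0; have [B B0 fB] := tame_bounded tf.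
(* [Q] is chosen first because the precision asked of [P] depends on a bound for [Q]. *)
have [Q gQ] := tg _ (divr_gt0 e0 B0).
have [C C0 QC] := tame_bounded (tame_horner Q).
have [P fP] := tf _ (divr_gt0 e0 C0).
exists (P * Q) => m; rewrite hornerM.
have -> : f m * g m - P.[m%:R] * Q.[m%:R] =
  (g m - Q.[m%:R]) * f m + (f m - P.[m%:R]) * Q.[m%:R] by ring.
apply: pabsD_le; rewrite pabsM.
  by rewrite -(divfK (lt0r_neq0 B0) e); apply: ler_pM; rewrite ?pabs_ge0.
by rewrite -(divfK (lt0r_neq0 C0) e); apply: ler_pM; rewrite ?pabs_ge0.
Qed.

Lemma tame_sum (I : Type) (r : seq I) (g : I -> nat -> K) :
  (forall i, tame (g i)) -> tame (fun m => \sum_(i <- r) g i m).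
Proof.
move=> tg; elim: r => [|i r IH].
  by apply: eq_tame (tame_cst 0) => m; rewrite big_nil.
by apply: eq_tame (tameD (tg i) IH) => m; rewrite big_cons.
Qed.

Lemma tame_prod (I : Type) (r : seq I) (g : I -> nat -> K) :
  (forall i, tame (g i)) -> tame (fun m => \prod_(i <- r) g i m).
Proof.
move=> tg; elim: r => [|i r IH].
  by apply: eq_tame (tame_cst 1) => m; rewrite big_nil.
by apply: eq_tame (tameM (tg i) IH) => m; rewrite big_cons.
Qed.

Lemma tame_approx f :
  (forall e, 0 < e -> exists2 g, tame g & forall m, pabs (f m - g m) <= e) ->
  tame f.
Proof.
move=> fg e e0; have [g tg hg] := fg e e0; have [P gP] := tg e e0.
by exists P => m; rewrite -(subrKA (g m)); exact: pabsD_le.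
Qed.

Lemma tame_shift f M : tame f -> tame (fun m => f (M + m)%N).
Proof.
move=> tf e e0; have [P fP] := tf e e0; exists (P \Po ('X + M%:R%:P)) => m.
by rewrite horner_comp !hornerE -natrD addnC.
Qed.

Definition fdiff f : nat -> K := fun m => f m.+1 - f m.

Lemma iter_fdiff_le f B k m : (forall m, pabs (f m) <= B) ->
  pabs (iter k fdiff f m) <= B.
Proof. by move=> fB; elim: k m => // k IH m; rewrite iterS; apply: pabsB_le. Qed.

Lemma iter_fdiffD f g c k m :
  iter k fdiff (fun m => f m + c * g m) m = iter k fdiff f m + c * iter k fdiff g m.
Proof. by elim: k m => // k IH m; rewrite !iterS /fdiff !IH; ring. Qed.

Lemma iter_fdiff_shift f k m :
  iter k fdiff (fun m => f m.+1) m = iter k.+1 fdiff f m + iter k fdiff f m.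
Proof.
have -> : iter k.+1 fdiff f m + iter k fdiff f m = iter k fdiff f m.+1.
  by rewrite iterS /fdiff subrK.
by elim: k m => // k IH m; rewrite !iterS /fdiff !IH.
Qed.

Definition pdiff P := P \Po ('X + 1) - P.

(** The leading terms of [('X + 1) ^+ i] and ['X ^+ i] cancel: their difference is a sum of products
    of [i - 1] linear factors. *)
Lemma size_pdiff P : (size (pdiff P) <= (size P).-1)%N.
Proof.
have -> : pdiff P = \sum_(i < size P) P`_i *: (('X + 1) ^+ i - 'X ^+ i).
  rewrite /pdiff comp_polyE -[X in _ - X]coefK poly_def -sumrB.
  by apply: eq_bigr => i _; rewrite scalerBr.
apply: (leq_trans (size_sum _ _ _)); apply/bigmax_leqP => i _.
apply: (leq_trans (size_scale_leq _ _)).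
rewrite subrXX addrAC subrr add0r mul1r.
apply: (leq_trans (size_sum _ _ _)); apply/bigmax_leqP => j _.
have X1 : ('X + 1 : {poly K}) = 'X - (-1)%:P by rewrite polyCN opprK.
rewrite size_mul ?expf_neq0 ?polyX_eq0//; last by rewrite X1 polyXsubC_eq0.
rewrite size_polyXn X1 size_exp_XsubC; case: i j => i /= iP [j /= ji]; lia.
Qed.

Lemma iter_fdiff_horner P k m :
  iter k fdiff (fun m => P.[m%:R]) m = (iter k pdiff P).[m%:R].
Proof.
elim: k m => // k IH m; rewrite !iterS /fdiff !IH /pdiff.
by rewrite hornerD hornerN horner_comp !hornerE natr1.
Qed.

Lemma iter_pdiff_eq0 P k : (size P <= k)%N -> iter k pdiff P = 0.
Proof.
move=> Pk; apply/eqP; rewrite -size_poly_leq0.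
suff : (size (iter k pdiff P) <= size P - k)%N.
  by move=> /leq_trans; apply; rewrite leq_subLR addn0.
elim: (k) => [|j IH] /=; first by rewrite subn0.
by apply: (leq_trans (size_pdiff _)); rewrite subnS -!subn1 leq_sub2r.
Qed.

(** From order [size P] on, the differences of an approximating polynomial [P] vanish; the error
    [f - P] keeps its bound [e], as differences never increase an ultrametric bound. *)
Lemma tame_iter_fdiff f e : tame f -> 0 < e ->
  exists d, forall k, (d <= k)%N -> forall m, pabs (iter k fdiff f m) <= e.
Proof.
move=> tf e0; have [P fP] := tf e e0; exists (size P) => k dk m.
have -> : f = (fun m => P.[m%:R] + 1 * (f m - P.[m%:R])).
  by apply/funext => i; rewrite mul1r addrC subrK.
rewrite iter_fdiffD iter_fdiff_horner iter_pdiff_eq0// horner0 add0r mul1r.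
exact: iter_fdiff_le.
Qed.

End Tame.

(** * The Euler transform *)

Section EulerTransform.
Context {R : realType} {K : ultrametricField R} {p : nat}.
Hypothesis hK : is_padic_complex p K.
Implicit Types (a c w x y z : K) (f : nat -> K) (e B : R) (P Q : {poly K}).

Lemma tame_series (g : nat -> nat -> K) : (forall n, tame (g n)) -> unif_null g ->
  tame (fun m => lim (series (g ^~ m) @ \oo)).
Proof.
move=> tg g0; apply: tame_approx => e e0; have [N hN] := g0 e e0.
exists (fun m => \sum_(0 <= n < N) g n m); first exact: tame_sum.
move=> m; have gm := unif_null_null m g0.
apply: (@lim_series_tail_le _ _ _ hK (g^~ m) e N) => [//||n Nn].
  exact: ltW.
exact: hN.
Qed.

(** Newton's expansion of [f m] has the terms [iter j fdiff f 0 * 'C(m, j)]; for |w| < 1, summing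
    ['C(m, j) * w ^+ m] over [m] gives [w ^+ j / (1 - w) ^+ j.+1]. *)
Definition euler_term w f (j : nat) : K :=
  iter j fdiff f 0%N * (w ^+ j / (1 - w) ^+ j.+1).

Definition euler w f : K := lim (series (euler_term w f) @ \oo).

(** Here all [w ^+ j / (1 - w) ^+ j.+1] have absolute value at most 1. The domain contains the open
    unit disc and, for odd [p] and |1 - q| < 1, the point [- q]. *)
Definition euler_domain w := pabs w <= 1 /\ pabs (1 - w) = 1.

Section Domain.
Context {w : K}.
Hypothesis hw : euler_domain w.

Let w1 : 1 - w != 0.
Proof. by rewrite -pabs_eq0 hw.2 oner_neq0. Qed.

Lemma pabs_euler_term f j : pabs (euler_term w f j) <= pabs (iter j fdiff f 0%N).
Proof.
apply: pabsM_le1 => //.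
by rewrite pabsM pabsV !pabsX hw.2 expr1n invr1 mulr1 exprn_ile1 ?pabs_ge0 ?hw.1.
Qed.

Lemma null_euler_term f : tame f -> null (euler_term w f).
Proof.
move=> tf e e0; have [d hd] := tame_iter_fdiff tf e0.
by exists d => n dn; apply: (le_trans (pabs_euler_term _ _)); exact: hd.
Qed.

Lemma cvg_euler f : tame f -> series (euler_term w f) @ \oo --> euler w f.
Proof. by move=> /null_euler_term; exact: (is_cvg_series_null hK). Qed.

Lemma euler_le f B : tame f -> (forall m, pabs (f m) <= B) ->
  pabs (euler w f) <= B.
Proof.
move=> tf fB; apply: (lim_series_le hK); first exact: null_euler_term.
  exact: le_trans (pabs_ge0 _) (fB 0%N).
by move=> j; apply: (le_trans (pabs_euler_term _ _)); apply: iter_fdiff_le.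
Qed.

Lemma euler_linear f g c : tame f -> tame g ->
  euler w (fun m => f m + c * g m) = euler w f + c * euler w g.
Proof.
move=> tf tg; have tfg := tameD tf (tameM (tame_cst c) tg).
apply: (cvg_pabs_unique (cvg_euler tfg)); apply/cvg_pabsP => e e0.
(* The summand 1 keeps the divisor positive when [c = 0]. *)
have c0 : 0 < 1 + pabs c by rewrite ltr_wpDr ?pabs_ge0.
have /cvg_pabsP/(_ e e0)[N hN] := cvg_euler tf.
have /cvg_pabsP/(_ _ (divr_gt0 e0 c0))[M hM] := cvg_euler tg.
exists (maxn N M) => n; rewrite geq_max => /andP[Nn Mn].
have -> : series (euler_term w (fun m => f m + c * g m)) n =
    series (euler_term w f) n + c * series (euler_term w g) n.
  rewrite /series /= mulr_sumr -big_split /=; apply: eq_bigr => j _.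
  by rewrite /euler_term iter_fdiffD mulrDl -[c * _ * _]mulrA.
rewrite opprD addrACA -mulrBr; apply: pabsD_le; first exact: hN.
rewrite pabsM; apply: (@le_trans _ _ ((1 + pabs c) * (e / (1 + pabs c)))).
  by apply: ler_pM; rewrite ?pabs_ge0 ?hM// lerDr.
by rewrite mulrC divfK// lt0r_neq0.
Qed.

Lemma euler_shift1 f : tame f -> euler w f = f 0%N + w * euler w (fun m => f m.+1).
Proof.
move=> tf; have tSf := tame_shift 1 tf.
apply: (cvg_pabs_unique (cvg_euler tf)); apply/cvg_pabsP => e e0.
have /cvg_pabsP/(_ e e0)[N hN] := cvg_euler tSf.
have [d hd] := tame_iter_fdiff tf e0.
exists (maxn N d) => n; rewrite geq_max => /andP[Nn dn].
(* The shift is 1 plus the difference operator, so the partial sums satisfy the recursion up to one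
   boundary term. It tends to 0 with the iterated differences, since [w / (1 - w)] has absolute
   value at most 1. *)
have telescope : series (euler_term w f) n =
    f 0%N - iter n fdiff f 0%N * (w / (1 - w)) ^+ n
    + w * series (euler_term w (fun m => f m.+1)) n.
  elim: {Nn dn} n => [|n IH].
    by rewrite /series /= !big_geq// expr0 mulr1 mulr0 subrr add0r.
  rewrite !seriesSr IH.
  rewrite /euler_term (iter_fdiff_shift f n 0) !exprMn !exprVn !exprS /=.
  have wn : (1 - w) ^+ n != 0 by rewrite expf_neq0.
  by field; rewrite wn w1.
have wn1 : pabs ((w / (1 - w)) ^+ n) <= 1.
  rewrite pabsX exprn_ile1 ?pabs_ge0// pabsM pabsV hw.2 invr1 mulr1; exact: hw.1.
set s := series (euler_term w (fun m => f m.+1)) n in telescope.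
have -> : series (euler_term w f) n - (f 0%N + w * euler w (fun m => f m.+1)) =
  (s - euler w (fun m => f m.+1)) * w - iter n fdiff f 0%N * (w / (1 - w)) ^+ n.
  by rewrite telescope; ring.
apply: pabsB_le; apply: pabsM_le1 => //; [exact: hN|exact: hw.1|exact: hd].
Qed.

Lemma euler_shift f M : tame f -> euler w f =
  \sum_(0 <= m < M) f m * w ^+ m + w ^+ M * euler w (fun m => f (M + m)%N).
Proof.
move=> tf; elim: M => [|M ->]; first by rewrite big_geq// add0r mul1r.
rewrite big_nat_recr//= -addrA euler_shift1; last exact: tame_shift.
rewrite addn0 mulrDr mulrA exprSr [w ^+ M * f M]mulrC.
by congr (_ + (_ + _ * euler w _)); apply/funext => m; rewrite addnS.
Qed.

(** Linearity handles the partial sums, and the sup bound [euler_le] the uniformly small tail. *)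
Lemma cvg_euler_series (g : nat -> nat -> K) :
  (forall n, tame (g n)) -> unif_null g ->
  series (fun n => euler w (g n)) @ \oo -->
    euler w (fun m => lim (series (g ^~ m) @ \oo)).
Proof.
move=> tg g0; have tG := tame_series tg g0.
have part N : series (fun n => euler w (g n)) N =
    euler w (fun m => \sum_(0 <= n < N) g n m).
  elim: N => [|N IH].
    (* The transform of the zero function vanishes by [euler_le] with bound 0. *)
    rewrite /series /= big_geq//; apply/esym/eqP; rewrite -pabs_eq0.
    apply/eqP/le_anti; rewrite pabs_ge0 andbT; apply: euler_le => [|m].
      exact: tame_sum.
    by rewrite big_geq// pabs0.
  rewrite seriesSr IH -[euler w (g N)]mul1r.
  rewrite -euler_linear//; last exact: tame_sum.
  by congr euler; apply/funext => m; rewrite mul1r big_nat_recr.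
apply/cvg_pabsP => e e0; have [N hN] := g0 e e0; exists N => n Nn.
rewrite part -mulN1r addrC [X in pabs X]addrC -euler_linear//; last exact: tame_sum.
apply: euler_le.
  by apply: tameD; [exact: tame_sum|apply: tameM => //; exact: tame_cst].
move=> m; rewrite mulN1r pabsB.
have gm := unif_null_null m g0.
apply: (@lim_series_tail_le _ _ _ hK (g^~ m) e n) => [//||k nk]; first exact: ltW.
exact/hN/(leq_trans Nn).
Qed.

End Domain.

(** By [euler_shift] the error after [n] terms is [w ^+ n] times a transform bounded independently
    of [n]. *)
Lemma cvg_series_euler f w : tame f -> pabs w < 1 ->
  series (fun m => f m * w ^+ m) @ \oo --> euler w f.
Proof.
move=> tf w1.
have hw : euler_domain w by split; [exact: ltW|rewrite pabs1D ?pabsN].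
have [B B0 fB] := tame_bounded tf.
have wnull : null (fun m => w ^+ m).
  by apply: (@null_geometric _ _ (pabs w)) => [|m]; rewrite ?pabs_ge0// pabsX.
apply/cvg_pabsP => e e0.
have [|N hN] := wnull (e / B); first by rewrite divr_gt0.
exists N => n Nn; rewrite (euler_shift hw n tf) /series /= opprD addrA subrr sub0r pabsN.
rewrite pabsM -(divfK (lt0r_neq0 B0) e); apply: ler_pM; rewrite ?pabs_ge0 ?hN//.
by apply: euler_le => //; exact: tame_shift.
Qed.

End EulerTransform.

(** * Factorials, p-adic integers and binomial coefficients in C_p *)

Section PadicComplex.
Context {R : realType} {K : ultrametricField R} {p : nat}.
Hypotheses (p_prime : prime p) (hK : is_padic_complex p K).
Implicit Types (a c q r t w x y z : K) (f : nat -> K) (e B : R) (P Q : {poly K}).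

Let p_gt0 : 0 < p%:R :> R. Proof. by rewrite ltr0n prime_gt0. Qed.

Let pV_lt1 : p%:R^-1 < 1 :> R.
Proof. by rewrite invf_lt1// ltr1n prime_gt1. Qed.

(** If |n| < 1, the left side of the Bezout relation [u * n = v * p + 1] would have absolute value
    below 1, but the right side has absolute value 1. *)
Lemma pabs_natr_coprime n : coprime p n -> pabs (n%:R : K) = 1.
Proof.
move=> pn; apply/le_anti; rewrite pabs_natr_le1 /= leNgt; apply/negP => n1.
have n0 : (0 < n)%N.
  by rewrite lt0n; apply: contraL pn => /eqP->; rewrite /coprime gcdn0 gtn_eqF ?prime_gt1.
have [u v uv _] := egcdnP p n0.
have : pabs ((u * n)%:R : K) < 1.
  rewrite natrM pabsM; apply: le_lt_trans n1.
  by rewrite ler_piMl ?pabs_ge0 ?pabs_natr_le1.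
rewrite uv gcdnC (eqP pn) natrD addrC pabs1D ?ltxx//.
rewrite natrM pabsM (pabs_p hK); apply: le_lt_trans pV_lt1.
by rewrite ler_piMl ?pabs_natr_le1// invr_ge0 ltW.
Qed.

Lemma null_pX : null (fun n => (p ^ n)%:R : K).
Proof.
apply: (@null_geometric _ _ p%:R^-1) => [|n]; first by rewrite invr_ge0 ltW.
by rewrite natrX pabsX (pabs_p hK).
Qed.

Lemma exp_radius_ge0 : 0 <= exp_radius p :> R.
Proof. exact: powR_ge0. Qed.

Lemma exp_radiusX : exp_radius p ^+ p.-1 = p%:R^-1 :> R.
Proof.
have p1 : (p.-1)%:R != 0 :> R by rewrite pnatr_eq0 -lt0n -subn1 subn_gt0 prime_gt1.
by rewrite /exp_radius -powR_mulrn ?powR_ge0// -powRrM mulNr mulVf// powR_inv1// ltW.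
Qed.

Lemma exp_radius_gt0 : 0 < exp_radius p :> R.
Proof. by apply: powR_gt0. Qed.

Lemma exp_radius_lt1 : exp_radius p < 1 :> R.
Proof.
rewrite ltNge; apply/negP => /(exprn_ege1 p.-1).
by rewrite exp_radiusX leNgt pV_lt1.
Qed.

Lemma logn_fact_le n : (p.-1 * logn p n`! <= n)%N.
Proof.
rewrite logn_fact//.
(* Legendre's formula, strengthened by a remainder: the induction closes because
   [p * (n %/ p ^ N.+1) <= n %/ p ^ N]. *)
suff H N : (p.-1 * (\sum_(1 <= k < N.+1) n %/ p ^ k) + n %/ p ^ N <= n)%N.
  exact: leq_trans (leq_addr _ _) (H n).
elim: N => [|N IH]; first by rewrite big_geq// muln0 expn0 divn1.
apply: leq_trans IH; rewrite big_nat_recr//= mulnDr -addnA leq_add2l.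
rewrite -[X in (_ + X <= _)%N]mul1n -mulnDl addn1 prednK ?prime_gt0//.
by rewrite expnSr divnMA mulnC leq_divM.
Qed.

(** With [v = logn p n!], the absolute value of [n!] is [p^-v], that is
    [exp_radius p ^+ (p.-1 * v)], and [p.-1 * v <= n]. *)
Lemma pabs_fact_ge n : exp_radius p ^+ n <= pabs (n`!%:R : K).
Proof.
have [m pm ->] := pfactor_coprime p_prime (fact_gt0 n).
rewrite natrM pabsM pabs_natr_coprime// mul1r natrX pabsX (pabs_p hK).
rewrite -exp_radiusX -exprM; apply: ler_wiXn2l; last exact: logn_fact_le.
  exact: exp_radius_ge0.
by rewrite ltW// exp_radius_lt1.
Qed.

Lemma fact_neq0 n : (n`!%:R : K) != 0.
Proof.
rewrite -pabs_eq0 gt_eqF// (lt_le_trans _ (pabs_fact_ge n))// exprn_gt0//.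
exact: exp_radius_gt0.
Qed.

Lemma padic_int_natr a e : padic_int a -> 0 < e ->
  exists n : nat, pabs (a - n%:R) <= e.
Proof.
move=> aZ e0; have [_ [[i _ <-]]] := aZ _ (nbhsx_ballx a e e0).
rewrite ball_pabs => /ltW ai; case: i ai => n; first by exists n.
rewrite NegzE => an; have [N hN] := null_pX e0.
(* This natural number is [- n.+1 + n.+1 * p ^ N], which is p-adically close to [- n.+1]. *)
exists (n.+1 * (p ^ N).-1)%N.
have -> : a - (n.+1 * (p ^ N).-1)%:R =
    (a - (- (n.+1)%:Z)%:~R) - (p ^ N)%:R * n.+1%:R.
  rewrite -[in RHS](prednK (n := p ^ N)) ?expn_gt0 ?prime_gt0//.
  by rewrite mulrNz opprK -[(p ^ N).-1.+1]addn1 natrD !natrM /= -pmulrn; ring.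
by apply: pabsB_le => //; apply: pabsM_le1; [exact: hN|exact: pabs_natr_le1].
Qed.

Lemma pabs_padic_int a : padic_int a -> pabs a <= 1.
Proof.
move=> /padic_int_natr/(_ ltr01)[n an]; rewrite -(subrK n%:R a).
by apply: pabsD_le => //; exact: pabs_natr_le1.
Qed.

Lemma padic_intD_natr a m : padic_int a -> padic_int (a + m%:R).
Proof.
move=> aZ W /nbhs_ballP[e /= e0 eW].
have [n an] := padic_int_natr aZ (divr_gt0 e0 (ltr0n R 2)).
exists (n + m)%:R; split; first by exists (n + m)%N%:Z.
apply: eW; rewrite ball_pabs natrD [n%:R + _]addrC addrKA.
by apply: le_lt_trans an _; rewrite gtr_pMr// invf_lt1// ltr1n.
Qed.

Lemma padic_int0 : padic_int (0 : K).
Proof. by apply: subset_closure; exists 0. Qed.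

Definition gbinom_poly n : {poly K} := (n`!%:R)^-1 *: \prod_(i < n) ('X - i%:R%:P).

Lemma horner_gbinom_poly a n : (gbinom_poly n).[a] = gbinom a n.
Proof.
rewrite /gbinom_poly hornerZ horner_prod mulrC /gbinom.
by congr (_ / _); apply: eq_bigr => i _; rewrite !hornerE.
Qed.

Lemma gbinom_natr m n : gbinom (m%:R : K) n = 'C(m, n)%:R.
Proof.
apply: (mulIf (fact_neq0 n)); rewrite /gbinom divfK ?fact_neq0//.
rewrite -natrM bin_ffact; elim: n => [|n IH]; first by rewrite big_ord0.
rewrite big_ord_recr /= IH ffactnSr natrM; have [nm|mn] := leqP n m.
  by rewrite natrB.
by rewrite ffact_small// !mul0r.
Qed.

(** At naturals the value is an ordinary binomial coefficient, hence of absolute value at most 1;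
    density of the naturals and Lipschitz continuity extend the bound to Z_p. *)
Lemma pabs_gbinom_padic_int a n : padic_int a -> pabs (gbinom a n) <= 1.
Proof.
move=> aZ; have [B B0 hB] := horner_lipschitz (gbinom_poly n).
have B1 : 0 < B + 1 by rewrite ltr_wpDl.
have [m am] := padic_int_natr aZ (divr_gt0 ltr01 B1).
rewrite -(subrK (gbinom m%:R n) (gbinom a n)); apply: pabsD_le; last first.
  by rewrite gbinom_natr pabs_natr_le1.
rewrite -!horner_gbinom_poly.
have [_ h] := hB a m%:R (pabs_padic_int aZ) (pabs_natr_le1 m).
apply: (le_trans h); rewrite -(divfK (lt0r_neq0 B1) 1) mulrC.
by apply: ler_pM; rewrite ?pabs_ge0// lerDl.
Qed.

Lemma tame_gbinom f n : tame f -> tame (fun m => gbinom (f m) n).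
Proof.
move=> tf; apply: tameM; last exact: tame_cst.
apply: tame_prod => i; apply: tameD => //; exact: tame_cst.
Qed.

(** An approximating polynomial is Lipschitz and [p ^ n] tends to 0, so the estimate is uniform in
    [m]. *)
Lemma tame_padic_continuous f e : tame f -> 0 < e ->
  exists N, forall n, (N <= n)%N -> forall m, pabs (f m - f (p ^ n + m)%N) <= e.
Proof.
move=> tf e0; have [P fP] := tf e e0; have [B B0 hB] := horner_lipschitz P.
have B1 : 0 < B + 1 by rewrite ltr_wpDl.
have [N hN] := null_pX (divr_gt0 e0 B1); exists N => n Nn m.
have -> : f m - f (p ^ n + m)%N = (f m - P.[m%:R]) -
    (f (p ^ n + m)%N - P.[(p ^ n + m)%:R] + (P.[(p ^ n + m)%:R] - P.[m%:R])) by ring.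
apply: pabsB_le => //; apply: pabsD_le => //.
have [_ h] := hB _ _ (pabs_natr_le1 (p ^ n + m)) (pabs_natr_le1 m).
apply: (le_trans h); rewrite natrD addrK -(divfK (lt0r_neq0 B1) e) mulrC.
by apply: ler_pM; rewrite ?pabs_ge0 ?hN// lerDl.
Qed.

Lemma tame_pow1p f s : tame f -> unif_null (fun n m => gbinom (f m) n * s ^+ n) ->
  tame (fun m => pow1p s (f m)).
Proof.
move=> tf; apply: (tame_series hK) => n.
by apply: tameM; [exact: tame_gbinom|exact: tame_cst].
Qed.

(** * The q-numbers and the powers of 1+t with these exponents *)

Section QNumber.
Context {q x : K}.
Hypotheses (hq : pabs (1 - q) < 1) (hx : padic_int x).

Let hq1 : pabs (q - 1) < 1. Proof. by rewrite pabsB. Qed.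

Let pabs_qpow_term a n : padic_int a ->
  pabs (gbinom a n * (q - 1) ^+ n) <= pabs (q - 1) ^+ n.
Proof.
by move=> aZ; rewrite mulrC -pabsX; apply: pabsM_le1 => //; exact: pabs_gbinom_padic_int.
Qed.

(** For [q != 1], the numerator [qpow q a - 1] is the binomial series without its constant term 1,
    and its terms are at most [pabs (q - 1)]. *)
Lemma pabs_qnum a : padic_int a -> pabs (qnum q a) <= 1.
Proof.
move=> aZ; rewrite /qnum; case: eqVneq => [_|q1]; first exact: pabs_padic_int.
have q10 : 0 < pabs (q - 1) by rewrite pabs_neq0// subr_eq0.
rewrite pabsM pabsV ler_pdivrMr// mul1r.
have nl : null (fun n => gbinom a n * (q - 1) ^+ n).
  apply: (@null_geometric _ _ (pabs (q - 1))) => [|n].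
    by rewrite pabs_ge0 hq1.
  exact: pabs_qpow_term.
have := @lim_series_tail_le _ _ _ hK _ (pabs (q - 1)) 1%N nl (pabs_ge0 _).
have -> : series (fun n => gbinom a n * (q - 1) ^+ n) 1 = 1.
  by rewrite /series /= big_nat1 /gbinom big_ord0 expr0 mulr1 divr1.
apply=> -[//|j] _; apply: (le_trans (pabs_qpow_term _ aZ)).
by rewrite exprS ler_piMr ?pabs_ge0// exprn_ile1 ?pabs_ge0// ltW.
Qed.

Lemma tame_qnum : tame (fun m => qnum q (x + m%:R)).
Proof.
have tx : tame (fun m => x + m%:R).
  by apply: eq_tame (tame_horner ('X + x%:P)) => m; rewrite !hornerE addrC.
rewrite /qnum; case: eqVneq => // q1.
apply: tameM; last exact: tame_cst.
apply: tameD; last exact: tame_cst.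
apply: tame_pow1p => //; apply: (@unif_null_geometric _ _ _ (pabs (q - 1))) => [|n m].
  by rewrite pabs_ge0 hq1.
by apply: pabs_qpow_term; exact: padic_intD_natr.
Qed.

(** A q-number need not lie in Z_p when [q] is in C_p, so its binomial coefficients are only bounded
    by 1/|n!|, hence by [(exp_radius p)^-n]. The terms then decay with ratio
    [pabs t / exp_radius p]. *)
Lemma unif_null_pow1p t : pabs t < exp_radius p ->
  unif_null (fun n m => gbinom (qnum q (x + m%:R)) n * t ^+ n).
Proof.
move=> ht; apply: (@unif_null_geometric _ _ _ (pabs t / exp_radius p)) => [|n m].
  by rewrite divr_ge0 ?pabs_ge0 ?exp_radius_ge0//= ltr_pdivrMr ?mul1r// exp_radius_gt0.
set a := qnum _ _; have a1 : pabs a <= 1 by apply/pabs_qnum/padic_intD_natr.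
have prod1 : pabs (\prod_(i < n) (a - i%:R)) <= 1.
  elim/big_ind: _ => [|y z y1 z1|i _]; first by rewrite pabs1.
    exact: pabsM_le1.
  by apply: pabsB_le => //; exact: pabs_natr_le1.
rewrite /gbinom -mulrA mulrC; apply: pabsM_le1 => //.
rewrite mulrC pabsM pabsX pabsV expr_div_n ler_wpM2l ?exprn_ge0 ?pabs_ge0//.
rewrite lef_pV2 ?pabs_fact_ge// posrE ?exprn_gt0 ?exp_radius_gt0//.
exact: pabs_neq0 (fact_neq0 n).
Qed.

End QNumber.

End PadicComplex.

(** * Krasner sums and fermionic integrals as Euler transforms *)

Section Sums.
Context {R : realType} {K : ultrametricField R} {p : nat}.
Hypotheses (p_prime : prime p) (p_odd : odd p) (hK : is_padic_complex p K).
Implicit Types (a c q r s t w x y z : K) (e B : R).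

Lemma krasner_sum_euler r (f : nat -> K) : euler_domain r -> tame f ->
  krasner_sum (fun m => r ^+ m * f m) (euler r f).
Proof.
move=> [r1 r1'] tf.
(* For [z] near 0, |r z| < 1; for [z] near 1, [r * z] differs from [r] by less than 1. *)
have dom z : residue_discs01 z -> euler_domain (r * z).
  move=> [z1|z1].
    have rz : pabs (r * z) < 1 by rewrite mulrC (le_lt_trans _ z1)// pabsM_le1.
    by split; [exact: ltW|rewrite pabs1D ?pabsN].
  have rz : pabs (r * (z - 1)) < 1 by rewrite mulrC (le_lt_trans _ z1)// pabsM_le1.
  split; last first.
    have -> : 1 - r * z = (1 - r) - r * (z - 1) by ring.
    by rewrite pabs_lt_eq ?pabsN r1'.
  have -> : r * z = r * (z - 1) + r by ring.
  by apply: pabsD_le => //; exact: ltW.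
have nz z : residue_discs01 z -> 1 - r * z != 0.
  by move=> /dom[_ h]; rewrite -pabs_eq0 h oner_neq0.
(* Numerator of the [k]-th partial sum of the transform at [r * z] over the common denominator
   [(1 - r z)^k]. *)
pose A k : {poly K} := \sum_(j < k)
  iter j fdiff f 0%N *: ((r *: 'X) ^+ j * (1 - r *: 'X) ^+ (k - j.+1)).
exists (fun z => euler (r * z) f), A, (fun k => (1 - r *: 'X) ^+ k); split.
- by move=> k z Dz; rewrite rootE !hornerE expf_neq0 ?nz.
- have AE k z : residue_discs01 z ->
      (A k).[z] / ((1 - r *: 'X) ^+ k).[z] = series (euler_term (r * z) f) k.
    move=> Dz; rewrite seriesEord /= horner_sum mulr_suml.
    apply: eq_bigr => j _; rewrite !hornerE /euler_term -!mulrA; congr (_ * (_ * _)).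
    rewrite -[X in _ / _ ^+ X](subnK (ltn_ord j)) exprD invfM mulrA mulfV ?mul1r//.
    by rewrite expf_neq0 ?nz.
  move=> W /uniform_nbhs[E [entE EW]].
  have [e e0 eE] : exists2 e : R, 0 < e & forall x y : K, ball x e y -> E (x, y).
    move: entE; rewrite -entourage_ballE => -[e /= e0 he]; exists e => // x y ?.
    exact: (he (x, y)).
  have e20 : 0 < e / 2 by rewrite divr_gt0.
  (* The differences of [f] bound the terms independently of [z], whence uniform convergence. *)
  have [N hN] := tame_iter_fdiff tf e20.
  exists N => // k /= Nk; apply: EW => z Dz; apply: eE.
  rewrite ball_pabs AE//; apply: (@le_lt_trans _ _ (e / 2)); last first.
    by rewrite gtr_pMr// invf_lt1// ltr1n.
  apply: (lim_series_tail_le hK) => [||j kj]; [|exact: ltW|].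
    by apply: null_euler_term => //; exact: dom.
  apply: (le_trans (pabs_euler_term (dom z Dz) f j)); apply: hN.
  exact: leq_trans kj.
- move=> z z1; have rz : pabs (r * z) < 1.
    by rewrite mulrC (le_lt_trans _ z1)// pabsM_le1.
  have := cvg_series_euler hK tf rz.
  by under eq_fun do rewrite exprMn mulrA [f _ * _]mulrC.
- by rewrite mulr1.
Qed.

(** Write [1 + q] as [2 - (1 - q)]; as [p] is odd, 2 has absolute value 1. *)
Lemma euler_domain_oppr q : pabs (1 - q) < 1 -> euler_domain (- q).
Proof.
move=> hq; have qE : q = 1 - (1 - q) by rewrite subKr.
split; first by rewrite pabsN qE; apply: pabsB_le; rewrite ?pabs1// ltW.
have two : pabs (2%:R : K) = 1.
  by rewrite (pabs_natr_coprime p_prime hK)// coprimen2.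
have -> : 1 - - q = 2%:R - (1 - q) by ring.
by rewrite pabs_lt_eq// pabsN two.
Qed.

Lemma fermionic_integral_euler q (f : K -> K) : pabs (1 - q) < 1 ->
  tame (fun m => f m%:R) ->
  fermionic_integral p q f = (1 + q) * euler (- q) (fun m => f m%:R).
Proof.
move=> hq tf; have dom := euler_domain_oppr hq.
have qn0 : 1 + q != 0 by rewrite -pabs_eq0 -[q in 1 + q]opprK dom.2 oner_neq0.
apply: cvg_lim; first exact: metric_hausdorff.
apply/cvg_pabsP => e e0; have [N hN] := tame_padic_continuous p_prime hK tf e0.
exists N => n Nn; set M := (p ^ n)%N.
have qM : (- q) ^+ M = - q ^+ M by rewrite exprNn -signr_odd oddX p_odd orbT expr1 mulN1r.
(* Since [q - 1] divides [q ^+ M - 1], [q ^+ M] is also close to 1, and [euler_domain_oppr] applies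
   to it. *)
have qM1 : pabs (1 - (- q) ^+ M) = 1.
  rewrite -(euler_domain_oppr (q := q ^+ M) _).2 ?qM//.
  rewrite pabsB subrX1; apply: le_lt_trans hq.
  rewrite pabsB; apply: pabsM_le1 => //; apply: pabs_sum_le => // i _.
  by rewrite pabsX exprn_ile1 ?pabs_ge0// -pabsN dom.1.
have qMn0 : 1 - (- q) ^+ M != 0 by rewrite -pabs_eq0 qM1 oner_neq0.
set g := fun m => f m%:R.
have tSg := tame_shift M tf.
(* The error is the effect of the shift by [M] on the transform, which is uniformly small, times a
   factor of absolute value at most 1. *)
have -> : ((1 - (- q) ^+ M) / (1 + q))^-1
    * (\sum_(0 <= y < M) f y%:R * (- q) ^+ y) - (1 + q) * euler (- q) g =
  (euler (- q) g - euler (- q) (fun m => g (M + m)%N)) *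
    ((- q) ^+ M * ((1 + q) / (1 - (- q) ^+ M))).
  have := euler_shift hK dom M tf; rewrite -/g => gE.
  have -> : \sum_(0 <= y < M) f y%:R * (- q) ^+ y =
    euler (- q) g - (- q) ^+ M * euler (- q) (fun m => g (M + m)%N).
    by rewrite gE addrK.
  by field; rewrite qn0 qMn0.
apply: pabsM_le1.
  have -> : euler (- q) g - euler (- q) (fun m => g (M + m)%N) =
    euler (- q) (fun m => g m + -1 * g (M + m)%N).
    by rewrite (euler_linear hK dom)// mulN1r.
  apply: (euler_le hK dom).
    by apply: tameD => //; apply: tameM => //; exact: tame_cst.
  by move=> m; rewrite mulN1r; exact: hN.
rewrite pabsM [pabs (_ / _)]pabsM pabsV qM1 invr1 mulr1 -[q in 1 + q]opprK dom.2 mulr1.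
by rewrite pabsX exprn_ile1 ?pabs_ge0 ?dom.1.
Qed.

(** * The generating function of the q-Changhee polynomials *)

Section Changhee.
Context {q x : K}.
Hypotheses (hq : pabs (1 - q) < 1) (hx : padic_int x).

Let dom := euler_domain_oppr hq.

Let a m := qnum q (x + m%:R).

Let tame_a : tame a. Proof. exact: (tame_qnum p_prime hK hq hx).
Qed.

Lemma tame_pow1p_qnum t : pabs t < exp_radius p -> tame (fun m => pow1p t (a m)).
Proof.
by move=> ht; apply: (tame_pow1p hK tame_a);
  exact: (unif_null_pow1p p_prime hK hq hx).
Qed.

Lemma cvg_Changhee_poly t : pabs t < exp_radius p ->
  series (fun n => Changhee_poly p q x n * (t ^+ n / n`!%:R)) @ \oo -->
    (1 + q) * euler (- q) (fun m => pow1p t (a m)).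
Proof.
move=> ht.
rewrite -(@fermionic_integral_euler q (fun y => pow1p t (qnum q (x + y))))//; last first.
  exact: tame_pow1p_qnum.
rewrite /Changhee_poly; set A := [set c | _].
(* [get] picks an element of [A] once [A] is inhabited; one sequence valid for every [t] has to be
   exhibited. *)
suff /getPex/(_ t ht) : exists c : nat -> K, A c by [].
(* Term-by-term integration of the binomial series: the coefficient of t^n/n! is [n!] times the
   integral of the [n]-th binomial coefficient. *)
exists (fun n => n`!%:R * ((1 + q) * euler (- q) (fun m => gbinom (a m) n))) => {ht}t ht.
rewrite fermionic_integral_euler//; last exact: tame_pow1p_qnum.
have tg n : tame (fun m => gbinom (a m) n * t ^+ n).
  by apply: tameM; [exact: tame_gbinom|exact: tame_cst].
have := cvg_euler_series hK dom tg (unif_null_pow1p p_prime hK hq hx ht).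
move=> /cvg_pabsP gE; apply/cvg_pabsP => e /gE[N hN]; exists N => n /hN.
have -> : series (fun n => n`!%:R * ((1 + q) * euler (- q) (fun m => gbinom (a m) n))
      * (t ^+ n / n`!%:R)) n =
    (1 + q) * series (fun n => euler (- q) (fun m => gbinom (a m) n * t ^+ n)) n.
  rewrite /series /= mulr_sumr; apply: eq_bigr => k _.
  have -> : (fun m => gbinom (a m) k * t ^+ k) = fun m => 0 + t ^+ k * gbinom (a m) k.
    by apply/funext => m; rewrite add0r mulrC.
  rewrite (euler_linear hK dom); [|exact: tame_cst|exact: tame_gbinom].
  have -> : euler (- q) (fun=> 0) = 0.
    apply/eqP; rewrite -pabs_eq0; apply/eqP/le_anti; rewrite pabs_ge0 andbT.
    by apply: (euler_le hK dom) => [|m]; [exact: tame_cst|rewrite pabs0].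
  by rewrite add0r; field; rewrite (fact_neq0 p_prime hK).
rewrite -mulrBr pabsM -[q in 1 + q]opprK dom.2 mul1r => h; exact: h.
Qed.

End Changhee.
End Sums.

Theorem theorem3 (R : realType) (p : nat) (p_prime : prime p) (p_odd : odd p)
    (Cp : ultrametricField R) (hCp : is_padic_complex p Cp)
    (q : Cp) (hq : pabs (1 - q) < exp_radius p)
    (x : Cp) (hx : padic_int x)
    (t : Cp) (ht : pabs t < exp_radius p) :
  (exists S : Cp,
     krasner_sum (fun m => (- q) ^+ m * pow1p t (qnum q (m%:R + x))) S /\
     series (fun n => Changhee_poly p q x n * (t ^+ n / n`!%:R)) @ \oo -->
       (1 + q) * S) /\
  (exists S : Cp,
     krasner_sum (fun m => (- q) ^+ m * pow1p t (qnum q m%:R)) S /\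
     series (fun n => Changhee_number p q n * (t ^+ n / n`!%:R)) @ \oo -->
       (1 + q) * S).
Proof.
have hq1 : pabs (1 - q) < 1 by apply: lt_trans hq _; exact: exp_radius_lt1.
have dom := euler_domain_oppr p_prime p_odd hCp hq1.
have main (y : Cp) : padic_int y -> exists S : Cp,
    krasner_sum (fun m => (- q) ^+ m * pow1p t (qnum q (m%:R + y))) S /\
    series (fun n => Changhee_poly p q y n * (t ^+ n / n`!%:R)) @ \oo -->
      (1 + q) * S.
  move=> hy; have tf := tame_pow1p_qnum p_prime hCp hq1 hy ht.
  (* The same Euler transform is the Krasner sum and, up to the factor [1 + q], the fermionic
     integral. *)
  exists (euler (- q) (fun m => pow1p t (qnum q (y + m%:R)))); split.
    under eq_fun do rewrite addrC; exact: (krasner_sum_euler hCp dom tf).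
  exact: (cvg_Changhee_poly p_prime p_odd hCp hq1 hy ht).
split; first exact: main.
have [S [sumS cvgS]] := main 0 padic_int0; exists S; split; last exact: cvgS.
by under eq_fun do rewrite -[_%:R]addr0.
Qed.
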